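(* Let $\mathcal{P}\in\mathcal{Q}_n$ be a sign pattern that allows singularity but is not sign singular, with signed directed graph $D$. If $\mathcal{P}\in\Delta$, then: (1) $D$ contains composite cycles of length $n$ of opposite signs; (2) if $D$ has no composite cycle of length $n-1$, then $D$ has a composite cycle of length $n-2$; (3) $D$ contains either a negative even cycle or two vertex-disjoint odd cycles of opposite sign; (4) $D$ contains two vertex-disjoint nonzero odd cycles of the same sign.
   Context: A sign pattern is a matrix with entries in $\{+,-,0\}$; $\mathcal{Q}_n$ is the set of $n\times n$ sign patterns; $\mathcal{Q}(\mathcal{P})$ is the set of real matrices whose entries have the signs prescribed by $\mathcal{P}$. $\mathcal{P}$ allows singularity if some matrix in $\mathcal{Q}(\mathcal{P})$ is singular, and is sign singular if every matrix in $\mathcal{Q}(\mathcal{P})$ is singular. $\Delta$ is the class of all sign patterns $\mathcal{P}$ for which every $A\in\mathcal{Q}(\mathcal{P})$ has exactly two real eigenvalues (with algebraic multiplicity). The signed directed graph $D$ of $\mathcal{P}=[p_{ij}]$ has vertices $1,\dots,n$ and arc $(i,j)$ (loops allowed) iff $p_{ij}\ne0$. A (nonzero) simple cycle $(i_1,\dots,i_k)$ has distinct vertices with $p_{i_1i_2},\dots,p_{i_ki_1}$ nonzero, length $k$ (even/odd accordingly) and sign $(-1)^{k-1}p_{i_1i_2}\cdots p_{i_ki_1}$. A composite cycle is a product of mutually vertex-disjoint simple cycles; its length is the sum of their lengths and its sign the product of their signs. *)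

(* Defs.v *)
From HB Require Import structures.
From mathcomp Require Import all_boot all_order all_algebra.
From mathcomp Require Import reals.

Set Implicit Arguments.
Unset Strict Implicit.
Unset Printing Implicit Defensive.

Import Order.TTheory GRing.Theory Num.Theory.
Local Open Scope ring_scope.

Inductive sign := SPlus | SMinus | SZero.

Definition sign_val (s : sign) : int :=
  match s with SPlus => 1 | SMinus => -1 | SZero => 0 end.

Definition qual_class (R : realType) (n : nat) (P : 'M[sign]_n) (A : 'M[R]_n)
    : Prop :=
  forall i j, sgz (A i j) = sign_val (P i j).

Definition allows_singularity (R : realType) (n : nat) (P : 'M[sign]_n) : Prop :=
  exists A : 'M[R]_n, qual_class P A /\ A \notin unitmx.

Definition sign_singular (R : realType) (n : nat) (P : 'M[sign]_n) : Prop :=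
  forall A : 'M[R]_n, qual_class P A -> A \notin unitmx.

(* [s] lists the distinct real eigenvalues of [A]; [mup a p] is the
   multiplicity of [a] as a root of [p], so the sum counts algebraic
   multiplicities. *)
Definition has_real_eigenvalues (R : realType) (n : nat) (A : 'M[R]_n) (m : nat)
    : Prop :=
  exists s : seq R,
    [/\ uniq s,
        forall a : R, (a \in s) = eigenvalue A a
      & (\sum_(a <- s) mup a (char_poly A))%N = m].

Definition in_Delta (R : realType) (n : nat) (P : 'M[sign]_n) : Prop :=
  forall A : 'M[R]_n, qual_class P A -> has_real_eigenvalues A 2.

Section SignedDigraph.

Variables (n : nat) (P : 'M[sign]_n).

Definition arc : rel 'I_n := [rel i j | sign_val (P i j) != 0].

(* The cycle (i_1, ..., i_k) is the sequence [:: i_1; ...; i_k]; its rotations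
   represent the same cycle. A loop is a sequence of size 1. *)
Definition simple_cycle (c : seq 'I_n) : bool :=
  (c != [::]) && ucycleb arc c.

Definition cycle_sign (c : seq 'I_n) : int :=
  (-1) ^+ (size c).-1 * \prod_(i <- c) sign_val (P i (next c i)).

Definition vertex_disjoint (c d : seq 'I_n) : bool := [disjoint c & d].

(* A composite cycle has at least one factor; a simple cycle is a composite
   cycle with a single factor. *)
Definition composite_cycle (C : seq (seq 'I_n)) : bool :=
  [&& C != [::], all simple_cycle C & pairwise vertex_disjoint C].

Definition composite_length (C : seq (seq 'I_n)) : nat :=
  (\sum_(c <- C) size c)%N.

Definition composite_sign (C : seq (seq 'I_n)) : int :=
  \prod_(c <- C) cycle_sign c.

Definition has_composite_cycle (l : nat) : Prop :=
  exists C, composite_cycle C /\ composite_length C = l.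

End SignedDigraph.

(* Main.v *)
(* A singular and a nonsingular matrix in the class of P force two nonzero terms
   of the Leibniz expansion of the determinant, given by permutations s and t,
   to have opposite signs (s positive, t negative); this is (1). Non-real
   eigenvalues come in pairs, so n is even, and (3) is a parity argument on the
   signs of the cycles of t. If there is no composite cycle of length n - 1 or
   n - 2, a singular matrix has 0 as a root of multiplicity 3, whence (2).
   For (4), perturb a weighted permutation matrix of s inside the class of P.
   The unperturbed characteristic polynomial is a product over the cycles of s.
   A negative even cycle, given a large weight, makes it negative at 1 and -1
   and positive at 0, which two real roots do not allow. If all cycles
   were even and positive it would be a product of factors x^k + 1, bounded
   below by a multiple of 1 + x^n, and have no real root. So s has
   odd cycles, all its even cycles are positive, and parity yields two odd
   cycles of the same sign. *)

Require Import Defs.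
From HB Require Import structures.
From mathcomp Require Import all_boot all_order all_algebra.
From mathcomp Require Import all_fingroup.
From mathcomp Require Import reals.
From mathcomp Require Import polyrcf zify ring lra.

Set Implicit Arguments.
Unset Strict Implicit.
Unset Printing Implicit Defensive.

Import Order.TTheory GRing.Theory Num.Theory.
Local Open Scope ring_scope.

(** * Real polynomials with two roots *)

(** The list [s] reduces the search for a root to a finite one; each root found is divided out,
    which lowers the size. *)
Lemma root_free_factor (F : fieldType) (s : seq F) (p : {poly F}) :
  p != 0 -> (forall a, root p a -> a \in s) ->
  exists rs q, p = q * \prod_(x <- rs) ('X - x%:P) /\ forall x, ~~ root q x.
Proof.
have [k] := ubnP (size p); elim: k p => // k IHk p.
rewrite ltnS => le_pk p_neq0 sub_ps.
have [/hasP[a _ /factor_theorem[q def_p]]|/hasPn no_root] := boolP (has (root p) s).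
  have q_neq0 : q != 0 by apply: contraNneq p_neq0 => q0; rewrite def_p q0 mul0r.
  have [||b qb|rs [r [def_q no_root]]] := IHk q.
  - by apply: leq_trans le_pk; rewrite def_p size_Mmonic ?monicXsubC // size_XsubC addn2.
  - by [].
  - by apply: sub_ps; rewrite def_p rootM qb.
  exists (a :: rs), r; split=> //.
  by rewrite big_cons mulrCA mulrC -def_q.
exists [::], p; split=> [|x]; first by rewrite big_nil mulr1.
by have [/no_root|] := boolP (x \in s) => //; apply/contraNN/sub_ps.
Qed.

(** A monic polynomial is positive far to the right, so a nonpositive value would force a root in
    between. *)
Lemma monic_root_free_gt0 (R : rcfType) (q : {poly R}) :
  q \is monic -> (forall x, ~~ root q x) -> forall x, 0 < q.[x].
Proof.
move=> /monicP q_monic no_root x.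
have [|z z_lc] := @poly_pinfty_gt_lc _ q; first by rewrite q_monic.
rewrite ltNge; apply/negP => qx_le0.
have xz : x <= Num.max x z by rewrite le_max lexx.
have q_gt0 : 0 < q.[Num.max x z].
  by apply: lt_le_trans (z_lc _ _); rewrite ?q_monic // le_max lexx orbT.
have [y _] := polyrcf.poly_ivt xz (mulr_le0_ge0 qx_le0 (ltW q_gt0)).
exact/negP.
Qed.

Lemma monic_root_free_even (R : rcfType) (q : {poly R}) :
  q \is monic -> (forall x, ~~ root q x) -> ~~ odd (size q).-1.
Proof.
move=> q_monic no_root; apply/negP => odd_q.
have q_gt0 := monic_root_free_gt0 q_monic no_root.
(* In odd degree [- q(-x)] is again monic and root-free, so both [q] and its negative would be
   positive at 0. *)
pose r := - (q \Po (- 'X)).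
have rE x : r.[x] = - q.[- x] by rewrite !hornerE horner_comp !hornerE.
have r_monic : r \is monic.
  rewrite monicE lead_coefN lead_coef_comp; last by rewrite size_polyN size_polyX.
  by rewrite (monicP q_monic) lead_coefN lead_coefX mul1r -signr_odd odd_q opprK.
have r_free x : ~~ root r x by rewrite /root rE oppr_eq0; apply: no_root.
have := monic_root_free_gt0 r_monic r_free 0.
by rewrite rE oppr_gt0 ltNge oppr0 ltW.
Qed.

(** Converts a sum of multiplicities over distinct eigenvalues into a number of linear factors. *)
Lemma sum_count_mem_sub (T : eqType) (s rs : seq T) :
  uniq s -> {subset rs <= s} -> (\sum_(a <- s) count_mem a rs)%N = size rs.
Proof.
move=> s_uniq sub_rs; under eq_bigr do rewrite -sum1_count big_mkcond.
rewrite exchange_big /= -sum1_size big_seq [RHS]big_seq.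
apply: eq_bigr => b /sub_rs b_s; rewrite -big_mkcond sum1_count.
by rewrite (eq_count (a2 := pred1 b)) ?count_uniq_mem ?b_s // => a; rewrite /= eq_sym.
Qed.

Lemma two_real_eigenvalues (R : realType) (n : nat) (A : 'M[R]_n) :
  has_real_eigenvalues A 2 ->
  ~~ odd n /\ exists a b q,
    char_poly A = q * (('X - a%:P) * ('X - b%:P)) /\ forall x, 0 < q.[x].
Proof.
move=> [s [s_uniq s_eig mup2]].
have p_neq0 := monic_neq0 (char_poly_monic A).
have s_root a : (a \in s) = root (char_poly A) a by rewrite s_eig eigenvalue_root_char.
have [a|rs [q [pE q_free]]] := @root_free_factor _ s _ p_neq0; first by rewrite s_root.
have rs_s : {subset rs <= s}.
  by move=> a ars; rewrite s_root pE rootM root_prod_XsubC ars orbT.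
have size_rs : size rs = 2.
  rewrite -(sum_count_mem_sub s_uniq rs_s) -[RHS]mup2.
  by apply: eq_bigr => a _; rewrite pE mupMr ?q_free // mu_prod_XsubC.
case: rs size_rs {rs_s} pE => [|a [|b [|//]]] // _.
rewrite big_cons big_seq1 => pE.
have ab_monic : ('X - a%:P) * ('X - b%:P) \is monic by rewrite monicMl monicXsubC.
have q_monic : q \is monic by rewrite -(monicMr _ ab_monic) -pE char_poly_monic.
split; last by exists a, b, q; split=> //; apply: monic_root_free_gt0.
have := monic_root_free_even q_monic q_free.
have := size_char_poly A; rewrite pE size_Mmonic ?monic_neq0 //.
rewrite size_Mmonic ?monicXsubC ?polyXsubC_eq0 // !size_XsubC /= addn3 /= => -[<-].
by rewrite -{2}(@prednK (size q)) //= ?negbK // size_poly_gt0 monic_neq0.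
Qed.

Lemma two_real_eigenvalues_exists (R : realType) (n : nat) (A : 'M[R]_n) :
  has_real_eigenvalues A 2 -> exists x, (char_poly A).[x] = 0.
Proof.
move=> /two_real_eigenvalues[_ [a [b [q [-> _]]]]].
by exists a; apply/rootP; rewrite !rootM root_XsubC eqxx orbT.
Qed.

(* With [q > 0] and real roots [a], [b], the signs at -1, 0, 1 are those of the
   convex parabola [(x - a) (x - b)], so they cannot be -, +, -. *)
Lemma two_real_eigenvalues_sign (R : realType) (n : nat) (A : 'M[R]_n) :
  has_real_eigenvalues A 2 -> (char_poly A).[1] < 0 ->
  (char_poly A).[-1] < 0 -> (char_poly A).[0] <= 0.
Proof.
move=> /two_real_eigenvalues[_ [a [b [q [-> q_gt0]]]]].
rewrite !(hornerM, hornerXsubC) !(pmulr_rlt0 _ (q_gt0 _)) (pmulr_rle0 _ (q_gt0 _)).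
nra.
Qed.

(** * Perturbation of the characteristic polynomial *)

Lemma poly_lipschitz0 (R : realFieldType) (q : {poly R}) :
  exists2 K, 0 <= K & forall e, `|e| <= 1 -> `|q.[e] - q.[0]| <= K * `|e|.
Proof.
elim/poly_ind: q => [|q c _].
  by exists 0 => // e _; rewrite !horner0 subrr normr0 mul0r.
(* The constant [c] cancels and leaves [q.[e] * e], where [q.[e]] is bounded by the absolute
   coefficients of [q]. *)
exists (\sum_(i < size q) `|q`_i|) => [|e e_le1]; first exact: sumr_ge0.
rewrite !hornerMXaddC mulr0 add0r addrK normrM ler_wpM2r // horner_coef.
apply: le_trans (ler_norm_sum _ _ _) _; apply: ler_sum => i _.
by rewrite normrM normrX ler_piMr // exprn_ile1.
Qed.

Lemma exprn_le_1D (R : realFieldType) (t : R) (k n : nat) :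
  0 <= t -> (k <= n)%N -> t ^+ k <= 1 + t ^+ n.
Proof.
move=> t0 kn; have [t1|t1] := leP t 1.
  by rewrite ler_wpDr ?exprn_ge0 // exprn_ile1.
by rewrite ler_wpDl // ler_weXn2l // ltW.
Qed.

(** The weight [1 + |x| ^ n] dominates every monomial of degree at most [n], so closeness of the
    coefficients gives a bound valid at all [x], even at a root whose position is unknown. *)
Lemma char_poly_perturbation (R : realFieldType) (n : nat) (A B : 'M[R]_n) (eta : R) :
  0 < eta -> exists2 e, 0 < e & forall x,
    `|(char_poly (A + e *: B)).[x] - (char_poly A).[x]| <= eta * (1 + `|x| ^+ n).
Proof.
move=> eta_gt0.
(* The coefficients of [char_poly (A + e *: B)] are polynomials in [e]. *)
pose M : 'M[{poly R}]_n := map_mx polyC A + 'X *: map_mx polyC B.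
have coefM e k : (char_poly (A + e *: B))`_k = ((char_poly M)`_k).[e].
  have -> : A + e *: B = map_mx (horner_eval e) M.
    by apply/matrixP=> i j; rewrite !mxE /horner_eval !hornerE.
  by rewrite -map_char_poly coef_map.
have [K K_ge0 KP] : exists2 K, 0 <= K & forall k, (k < n.+1)%N -> forall e, `|e| <= 1 ->
    `|((char_poly M)`_k).[e] - ((char_poly M)`_k).[0]| <= K * `|e|.
  elim: (n.+1) => [|m [K K_ge0 KP]]; first by exists 0.
  have [L L_ge0 LP] := poly_lipschitz0 (char_poly M)`_m.
  exists (K + L) => [|k]; first exact: addr_ge0.
  rewrite ltnS leq_eqVlt => /predU1P[->|km] e e_le1.
    by apply: le_trans (LP e e_le1) _; rewrite ler_wpM2r ?lerDr.
  by apply: le_trans (KP k km e e_le1) _; rewrite ler_wpM2r ?lerDl.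
(* With [e = eta / D], the summand [eta] ensures [e <= 1] and the last summand ensures that [n.+1]
   errors [K * e] add up to at most [eta]. *)
pose D := 1 + eta + K * n.+1%:R.
have Kn_ge0 : 0 <= K * n.+1%:R by rewrite mulr_ge0.
have D_gt0 : 0 < D by rewrite /D; lra.
exists (eta / D) => [|x]; first exact: divr_gt0.
set e := eta / D.
have e_gt0 : 0 < e by apply: divr_gt0.
have e_le1 : `|e| <= 1 by rewrite gtr0_norm // ler_pdivrMr // /D; lra.
have Ke : K * e * n.+1%:R <= eta.
  rewrite /e mulrAC mulrA ler_pdivrMr // /D; nra.
rewrite !(@horner_coef_wide _ n.+1) ?size_char_poly // -sumrB.
apply: le_trans (ler_norm_sum _ _ _) _.
have hx : 0 <= 1 + `|x| ^+ n by rewrite addr_ge0 ?exprn_ge0.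
apply: (@le_trans _ _ (\sum_(i < n.+1) K * e * (1 + `|x| ^+ n))); last first.
  by rewrite sumr_const card_ord -[leLHS]mulr_natr mulrAC ler_wpM2r.
apply: ler_sum => i _.
have A0 : A = A + 0 *: B by rewrite scale0r addr0.
rewrite -mulrBl normrM normrX {2}A0 !coefM; apply: ler_pM => //.
- by rewrite exprn_ge0.
- by rewrite -{2}(gtr0_norm e_gt0) KP.
- by apply: exprn_le_1D; rewrite // -ltnS.
Qed.

(** * Determinant of a weighted permutation matrix *)

Lemma horner_char_poly (R : comNzRingType) (n : nat) (A : 'M[R]_n) (x : R) :
  (char_poly A).[x] = \det (x%:M - A).
Proof.
rewrite -[LHS]/(horner_eval x (\det (char_poly_mx A))) -det_map_mx.
congr determinant; apply/matrixP=> i j; rewrite !mxE /=.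
by rewrite /horner_eval hornerD hornerN hornerMn hornerX hornerC.
Qed.

Section Porbits.

Variables (T : finType) (s : {perm T}).

Lemma mem_porbit_perm x y : (s y \in porbit s x) = (y \in porbit s x).
Proof. by rewrite -!eq_porbit_mem -[s y]/((s ^+ 1)%g y) porbit_perm. Qed.

Lemma porbit_mem C x : C \in porbits s -> x \in C -> C = porbit s x.
Proof. by case/imsetP=> y _ -> xy; apply/eqP; rewrite eq_sym eq_porbit_mem. Qed.

Lemma porbits_disjoint C D : C \in porbits s -> D \in porbits s -> C != D -> [disjoint C & D].
Proof.
move=> Cs Ds; apply: contraNT => /pred0Pn[x /andP[/= xC xD]].
by rewrite (porbit_mem Cs xC) (porbit_mem Ds xD).
Qed.

Lemma porbits_card_gt0 C : C \in porbits s -> (0 < #|C|)%N.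
Proof. by case/imsetP=> x _ ->; rewrite lt0n card_porbit_neq0. Qed.

(** A set stable under [s] is a union of orbits. *)
Lemma big_porbits_sub (R : Type) (idx : R) (op : Monoid.com_law idx) (A : {set T}) (F : T -> R) :
  {in A, forall x, s x \in A} ->
  \big[op/idx]_(i in A) F i = \big[op/idx]_(C in porbits s | C \subset A) \big[op/idx]_(i in C) F i.
Proof.
move=> stableA.
have stable_exp k x : x \in A -> (s ^+ k)%g x \in A.
  by move=> xA; elim: k => [|k IHk]; rewrite ?expg0 ?perm1 // expgSr permM stableA.
rewrite (partition_big (porbit s) (fun C => (C \in porbits s) && (C \subset A))) /=.
  apply: eq_bigr => C /andP[Cs CA]; apply: eq_bigl => i.
  apply/andP/idP => [[_ /eqP <-]|iC]; first exact: porbit_id.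
  by rewrite (subsetP CA) // -(porbit_mem Cs iC).
move=> i iA; rewrite imset_f //=; apply/subsetP=> j /porbitP[k ->].
exact: stable_exp.
Qed.

Lemma big_porbits (R : Type) (idx : R) (op : Monoid.com_law idx) (F : T -> R) :
  \big[op/idx]_i F i = \big[op/idx]_(C in porbits s) \big[op/idx]_(i in C) F i.
Proof.
have := @big_porbits_sub R idx op [set: T] F (fun _ _ => in_setT _).
rewrite (eq_bigl xpredT) => [->|i]; last exact: in_setT.
by apply: eq_bigl => C; rewrite subsetT andbT.
Qed.

(** The parity of [s] is defined from [#|T|] and the number of orbits; splitting [#|T|] into orbit
    sizes gives one factor per orbit. *)
Lemma sign_perm_porbits (R : comNzRingType) :
  (-1) ^+ s = \prod_(C in porbits s) (-1) ^+ #|C|.-1 :> R.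
Proof.
have cardT : #|T| = (\sum_(C in porbits s) #|C|)%N.
  rewrite -sum1_card (eq_bigl xpredT) // (big_porbits addn).
  by apply: eq_bigr => C _; rewrite sum1_card.
have signE C : C \in porbits s -> (-1) ^+ #|C|.-1 = (-1) ^+ #|C| * (-1) :> R.
  move=> Cs; rewrite -{2}(prednK (porbits_card_gt0 Cs)) exprS.
  by rewrite mulN1r mulrN1 opprK.
rewrite (eq_bigr _ signE) big_split /= prodr_const -expr_sum -cardT.
by rewrite /odd_perm signr_addb !signr_odd.
Qed.

End Porbits.

Section WeightedPermutation.

Variables (R : comNzRingType) (n : nat) (s : 'S_n) (x : R) (w : 'I_n -> R).

(* The rows of [x - M] indexed by [S] and those of the identity matrix
   elsewhere, where [M] is the weighted permutation matrix of [s]; on unions of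
   cycles it is multiplicative in [S]. *)
Definition cycle_rows_mx (S : {set 'I_n}) : 'M[R]_n :=
  \matrix_(i, j) if i \in S then x *+ (i == j) - w i *+ (j == s i) else (i == j)%:R.

(** A row of the left factor indexed by [i] in [S] is supported on [i] and [s i], both in [S], where
    the right factor has rows of the identity; the other rows of the left factor select rows of the
    right one. *)
Lemma cycle_rows_mxU (S T : {set 'I_n}) :
  [disjoint S & T] -> {in S, forall i, s i \in S} ->
  cycle_rows_mx (S :|: T) = cycle_rows_mx S *m cycle_rows_mx T.
Proof.
move=> dST stableS; apply/matrixP=> i j; rewrite !mxE inE.
have [iS|iS] /= := boolP (i \in S); last first.
  rewrite (bigD1 i) //= big1 ?addr0 => [|k ki]; last first.
    by rewrite !mxE (negPf iS) eq_sym (negPf ki) mul0r.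
  by rewrite !mxE (negPf iS) eqxx mul1r.
have rowS k : k \in S -> cycle_rows_mx T k j = (k == j)%:R.
  by move=> kS; rewrite mxE (disjointFr dST kS).
under eq_bigr do rewrite mxE iS mulrBl.
rewrite sumrB (bigD1 i) //= [X in _ + X - _]big1 => [|k ki]; last first.
  by rewrite eq_sym (negPf ki) mul0r.
rewrite (bigD1 (s i)) //= [X in _ - (_ + X)]big1 => [|k ki]; last first.
  by rewrite (negPf ki) mul0r.
rewrite !eqxx !rowS ?stableS // !addr0 !mulr_natr.
by rewrite [s i == j]eq_sym.
Qed.

Lemma restr_perm_porbit (i0 i : 'I_n) :
  restr_perm (porbit s i0) s i = if i \in porbit s i0 then s i else i.
Proof.
have [iC|iC] := ifPn; last exact: out_perm (restr_perm_on _ _) iC.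
rewrite restr_permE //; apply/astabsP=> y /=.
by rewrite apermE mem_porbit_perm.
Qed.

(** Determines the sign of the cycle carried by [C]: its orbits are [C] and the singletons outside
    [C]. *)
Lemma porbits_restr_perm (i0 : 'I_n) :
  #|porbits (restr_perm (porbit s i0) s)| = (n - #|porbit s i0|).+1.
Proof.
set C := porbit s i0; set t := restr_perm C s.
have tE i : t i = if i \in C then s i else i by apply: restr_perm_porbit.
have t_exp k i : (t ^+ k)%g i = if i \in C then (s ^+ k)%g i else i.
  elim: k => [|k IHk]; first by rewrite !expg0 perm1; case: ifP.
  rewrite !expgSr !permM IHk tE.
  have [iC|/negPf->//] := ifPn (i \in C).
  by rewrite /C -eq_porbit_mem porbit_perm eq_porbit_mem iC.
have porbit_t i : porbit t i = if i \in C then C else [set i].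
  apply/setP=> j; apply/porbitP/idP => [[k ->]|].
    rewrite t_exp; have [iC|iC] := ifPn (i \in C); last exact: set11.
    by rewrite /C -eq_porbit_mem porbit_perm eq_porbit_mem iC.
  have [iC|iC] := ifPn (i \in C); last first.
    by move=> /set1P->; exists 0%N; rewrite expg0 perm1.
  have -> : C = porbit s i by apply/eqP; rewrite eq_sym eq_porbit_mem.
  by case/porbitP=> k ->; exists k; rewrite t_exp iC.
have -> : porbits t = C |: [set [set i] | i in ~: C].
  apply/setP=> D; rewrite in_setU1; apply/imsetP/orP => [[i _ ->]|].
    rewrite porbit_t; have [_|iC] := ifPn (i \in C); first by left.
    by right; rewrite imset_f // inE.
  case=> [/eqP->|/imsetP[i]].
    by exists i0; rewrite // porbit_t porbit_id.
  by rewrite inE => iC ->; exists i; rewrite // porbit_t (negPf iC).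
rewrite cardsU1 card_imset; last exact: set1_inj.
rewrite cardsCs setCK card_ord (_ : C \notin _ = true) //.
apply/imsetP=> -[i]; rewrite inE => iC CE.
by rewrite CE set11 in iC.
Qed.

(** Only two permutations contribute to the determinant: the identity, giving the power of [x], and
    the cycle of [s] on [C], giving the weights. *)
Lemma det_cycle_rows_porbit (i0 : 'I_n) (C := porbit s i0) :
  \det (cycle_rows_mx C) = x ^+ #|C| - \prod_(i in C) w i.
Proof.
set N := cycle_rows_mx C.
have N_out i j : i \notin C -> N i j = (i == j)%:R by rewrite mxE => /negPf->.
have big_in (t : 'S_n) : (forall i, i \notin C -> t i = i) ->
    \prod_i N i (t i) = \prod_(i in C) N i (t i).
  move=> t_out; rewrite (bigID (mem C)) /= [X in _ * X]big1 ?mulr1 // => i iC.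
  by rewrite N_out // t_out // eqxx.
have NinE i j : i \in C -> N i j = x *+ (i == j) - w i *+ (j == s i).
  by rewrite mxE => ->.
(* At a fixed point the two contributing permutations coincide, and both terms sit in one diagonal
   entry. *)
have [s_i0|s_i0] := eqVneq (s i0) i0.
  have C1 : C = [set i0].
    apply/setP=> j; rewrite inE; apply/porbitP/eqP => [[k ->]|->].
      by elim: k => [|k IHk]; rewrite ?expg0 ?perm1 // expgSr permM IHk.
    by exists 0%N; rewrite expg0 perm1.
  rewrite /determinant (bigD1 1%g) //= [X in _ + X]big1 => [|t t_neq1]; last first.
    have [i ti] : exists i, t i != i.
      apply/existsP; apply: contraNT t_neq1 => /existsPn t1.
      by apply/eqP/permP=> i; rewrite perm1; apply/eqP/negPn.
    rewrite (bigD1 i) //= (_ : N i (t i) = 0) ?mul0r ?mulr0 //.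
    have [iC|iC] := boolP (i \in C); last by rewrite N_out // [i == _]eq_sym (negPf ti).
    rewrite NinE //; move: iC ti; rewrite C1 inE => /eqP-> ti.
    by rewrite s_i0 eq_sym (negPf ti) subr0.
  rewrite odd_perm1 expr0 mul1r addr0 big_in => [|i _]; last by rewrite perm1.
  by rewrite C1 !big_set1 cards1 expr1 NinE ?C1 ?inE // perm1 s_i0 eqxx.
have s_neq i : i \in C -> s i != i.
  move=> /porbitP[k ->]; apply: contraNneq s_i0 => /eqP.
  by rewrite -permM -expgSr expgS permM (inj_eq perm_inj).
pose c := restr_perm C s.
have cE i : c i = if i \in C then s i else i by apply: restr_perm_porbit.
have c_neq1 : c != 1%g.
  apply/eqP=> /permP/(_ i0); rewrite cE porbit_id perm1.
  exact/eqP.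
rewrite /determinant (bigD1 1%g) //= (bigD1 c) //= [X in _ + (_ + X)]big1 => [|t]; last first.
  move=> /andP[t_neq1 t_neqc].
  have [t_prod|] := boolP [exists i, N i (t i) == 0].
    have /existsP[i /eqP Ni] := t_prod.
    by rewrite (bigD1 i) //= Ni mul0r mulr0.
  move=> /existsPn Nt; case/negP: t_neqc.
  have t_out i : i \notin C -> t i = i.
    move=> iC; apply/eqP; apply: contraNT (Nt i) => ti.
    by rewrite N_out // [i == _]eq_sym (negPf ti).
  have t_in i : i \in C -> t i = i \/ t i = s i.
    move=> iC; have [->|ti] := eqVneq (t i) i; first by left.
    right; apply/eqP; apply: contraNT (Nt i) => tsi.
    by rewrite NinE // [i == _]eq_sym (negPf ti) (negPf tsi) subr0.
  have [i ti] : exists i, t i != i.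
    apply/existsP; apply: contraNT t_neq1 => /existsPn t1.
    by apply/eqP/permP=> i; rewrite perm1; apply/eqP/negPn.
  have iC : i \in C by apply: contraNT ti => /t_out->.
  have CE : C = porbit s i by apply/eqP; rewrite eq_sym eq_porbit_mem.
  (* Once [t] follows [s] at one point it does so along the whole orbit: if [t] fixed [s y] with
     [t y = s y], injectivity would give [s y = y]. *)
  have t_exp k : t ((s ^+ k)%g i) = s ((s ^+ k)%g i).
    elim: k => [|k IHk].
      by rewrite expg0 perm1; case: (t_in i iC) => // tii; rewrite tii eqxx in ti.
    set y := (s ^+ k)%g i in IHk *.
    have yC : y \in C by rewrite CE mem_porbit.
    rewrite expgSr permM -/y; have [|t_sy|//] := t_in (s y).
      by rewrite /C mem_porbit_perm.
    by move: t_sy; rewrite -[RHS]IHk => /perm_inj syy; have := s_neq y yC; rewrite syy eqxx.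
  apply/eqP/permP=> j; rewrite cE; have [|/t_out//] := ifPn (j \in C).
  by rewrite CE => /porbitP[k ->].
rewrite addr0 odd_perm1 expr0 mul1r !big_in => [|i /negPf iC|i _]; last 2 first.
- by rewrite cE iC.
- by rewrite perm1.
have -> : \prod_(i in C) N i ((1%g : 'S_n) i) = \prod_(i in C) x.
  apply: eq_bigr => i iC.
  by rewrite NinE // perm1 eqxx [i == _]eq_sym (negPf (s_neq i iC)) subr0.
have -> : \prod_(i in C) N i (c i) = \prod_(i in C) - w i.
  apply: eq_bigr => i iC.
  by rewrite NinE // cE iC eqxx [i == _]eq_sym (negPf (s_neq i iC)) sub0r.
rewrite prodr_const prodrN mulrA; congr (_ + _).
(* The sign of [c] has exponent [n + (n - #|C|) + 1]; together with [(-1) ^ #|C|] from the weights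
   this makes -1. *)
rewrite /odd_perm porbits_restr_perm card_ord signr_addb !signr_odd -/C.
have le_Cn : (#|C| <= n)%N by have := max_card (mem C); rewrite card_ord.
rewrite -[X in (-1) ^+ X * _ * _](subnK le_Cn) exprD exprS !mulN1r.
rewrite mulrN !mulNr -mulrA -mulrA; congr (- _).
set a := _ ^+ (n - _); set b := _ ^+ #|C|.
have aa : a * a = 1 by rewrite -expr2 sqrr_sign.
have bb : b * b = 1 by rewrite -expr2 sqrr_sign.
by ring: aa bb.
Qed.

(** The matrix is [cycle_rows_mx setT], from which the orbits are split off one at a time by
    multiplicativity. *)
Lemma det_weighted_perm :
  \det (x%:M - \matrix_(i, j) (w i *+ (j == s i))) =
    \prod_(C in porbits s) (x ^+ #|C| - \prod_(i in C) w i).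
Proof.
have -> : x%:M - \matrix_(i, j) (w i *+ (j == s i)) = cycle_rows_mx setT.
  by apply/matrixP=> i j; rewrite !mxE inE.
have coverT : \bigcup_(C <- enum (porbits s)) C = setT.
  apply/setP=> i; rewrite inE big_enum /=; apply/bigcupP.
  by exists (porbit s i); rewrite ?porbit_id ?imset_f.
have all_porbits : {subset enum (porbits s) <= porbits s} by move=> C; rewrite mem_enum.
rewrite -coverT -[RHS]big_enum /=.
elim: (enum _) (enum_uniq (porbits s)) all_porbits => [|C r IHr] /= => [_ _|].
  rewrite !big_nil (_ : cycle_rows_mx set0 = 1%:M) ?det1 //.
  by apply/matrixP=> i j; rewrite !mxE inE.
move=> /andP[Cr r_uniq] sub_r; rewrite !big_cons.
have Cs : C \in porbits s by rewrite sub_r ?mem_head.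
have sub_rs : {subset r <= porbits s} by move=> D Dr; rewrite sub_r // inE Dr orbT.
rewrite cycle_rows_mxU ?det_mulmx ?IHr //; last first.
- by case/imsetP: Cs => i _ -> j; rewrite mem_porbit_perm.
- rewrite bigcup_seq; apply/bigcup_disjointP=> D Dr.
  by rewrite (porbits_disjoint Cs) ?sub_rs //; apply: contraNneq Cr => ->.
by congr (_ * _); case/imsetP: Cs => i _ ->; apply: det_cycle_rows_porbit.
Qed.

End WeightedPermutation.

(** * Cycles of the digraph from permutations *)

Section PermutationCycles.

Variables (n : nat) (P : 'M[sign]_n) (s : 'S_n).

Definition arc_sign (i : 'I_n) : int := sign_val (P i (s i)).

(** The start of the cycle is an arbitrary point of [C]; the empty list is a default that no orbit
    reaches. *)
Definition porbit_cycle (C : {set 'I_n}) : seq 'I_n :=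
  if [pick x in C] is Some x then traject s x #|C| else [::].

Definition porbit_sign (C : {set 'I_n}) : int :=
  (-1) ^+ #|C|.-1 * \prod_(i in C) arc_sign i.

Lemma porbit_cycleE (C : {set 'I_n}) : C \in porbits s ->
  exists2 x, C = porbit s x & porbit_cycle C = traject s x #|C|.
Proof.
move=> Cs; rewrite /porbit_cycle; case: pickP => [x xC|C0].
  by exists x; rewrite // (porbit_mem Cs xC).
by have := porbits_card_gt0 Cs; rewrite (eq_card0 C0).
Qed.

Lemma size_porbit_cycle (C : {set 'I_n}) : C \in porbits s -> size (porbit_cycle C) = #|C|.
Proof. by case/porbit_cycleE=> x _ ->; rewrite size_traject. Qed.

Lemma mem_porbit_cycle (C : {set 'I_n}) : C \in porbits s -> porbit_cycle C =i C.
Proof. by case/porbit_cycleE=> x -> -> y; rewrite porbit_traject. Qed.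

Lemma uniq_porbit_cycle (C : {set 'I_n}) : C \in porbits s -> uniq (porbit_cycle C).
Proof. by case/porbit_cycleE=> x -> ->; apply: uniq_traject_porbit. Qed.

Lemma fcycle_porbit_cycle (C : {set 'I_n}) : C \in porbits s -> fcycle s (porbit_cycle C).
Proof.
move=> Cs; case: (porbit_cycleE Cs) => x CE ->.
have := iter_porbit s x; rewrite -CE; have := porbits_card_gt0 Cs.
case: #|C| => // k _; rewrite iterSr => sk /=.
by rewrite -[X in rcons _ X]sk -trajectSr fpath_traject.
Qed.

Lemma simple_porbit_cycle (C : {set 'I_n}) :
  C \in porbits s -> {in C, forall i, arc_sign i != 0} -> simple_cycle P (porbit_cycle C).
Proof.
move=> Cs arcC; apply/andP; split.
  by rewrite -size_eq0 size_porbit_cycle // -lt0n (porbits_card_gt0 Cs).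
rewrite /ucycleb uniq_porbit_cycle // andbT.
apply: (sub_in_cycle (P := mem C) _ _ (fcycle_porbit_cycle Cs)).
  by move=> i j iC _ /eqP<-; apply: arcC.
by apply/allP=> i; rewrite mem_porbit_cycle.
Qed.

Lemma cycle_sign_porbit_cycle (C : {set 'I_n}) :
  C \in porbits s -> cycle_sign P (porbit_cycle C) = porbit_sign C.
Proof.
move=> Cs; rewrite /cycle_sign /porbit_sign size_porbit_cycle //; congr (_ * _).
rewrite -(eq_bigl _ _ (mem_porbit_cycle Cs)) -big_uniq ?uniq_porbit_cycle //=.
rewrite big_seq [RHS]big_seq; apply: eq_bigr => i iC.
by rewrite (nextE (fcycle_porbit_cycle Cs)).
Qed.

Lemma disjoint_porbit_cycle (C D : {set 'I_n}) :
  C \in porbits s -> D \in porbits s -> C != D ->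
  vertex_disjoint (porbit_cycle C) (porbit_cycle D).
Proof.
move=> Cs Ds CD; rewrite /vertex_disjoint (eq_disjoint (mem_porbit_cycle Cs)).
by rewrite disjoint_sym (eq_disjoint (mem_porbit_cycle Ds)) disjoint_sym (porbits_disjoint Cs).
Qed.

(** The passage from permutations to the digraph: the orbits inside [S] are disjoint simple cycles
    that cover it. *)
Lemma composite_porbit_cycles (S : {set 'I_n}) :
  S != set0 -> {in S, forall i, s i \in S} -> {in S, forall i, arc_sign i != 0} ->
  exists C, [/\ composite_cycle P C, composite_length C = #|S|
    & composite_sign P C = \prod_(D in porbits s | D \subset S) porbit_sign D].
Proof.
move=> S_neq0 stableS arcS.
pose K := enum [pred D : {set 'I_n} | (D \in porbits s) && (D \subset S)].
have KP D : D \in K = (D \in porbits s) && (D \subset S) by rewrite mem_enum.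
have lenK : composite_length [seq porbit_cycle D | D <- K] = #|S|.
  rewrite /composite_length big_map /K big_enum /= -sum1_card (big_porbits_sub addn _ stableS).
  by apply: eq_bigr => D /andP[Ds _]; rewrite size_porbit_cycle // sum1_card.
exists [seq porbit_cycle D | D <- K]; split=> //; last first.
  rewrite /composite_sign big_map /K big_enum /=.
  by apply: eq_bigr => D /andP[Ds _]; rewrite cycle_sign_porbit_cycle.
apply/and3P; split.
- apply: contraNneq S_neq0 => K0; rewrite -cards_eq0 -lenK K0.
  by rewrite /composite_length big_nil.
- apply/allP=> _ /mapP[D + ->]; rewrite KP => /andP[Ds DS].
  by apply: simple_porbit_cycle => // i iD; rewrite arcS // (subsetP DS).
- rewrite pairwise_map; have := enum_uniq [pred D : {set 'I_n} | (D \in porbits s) && (D \subset S)].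
  rewrite -/K uniq_pairwise; apply: (sub_in_pairwise (P := mem (porbits s))).
    by move=> D E Ds Es /= DE; apply: disjoint_porbit_cycle.
  by apply/allP=> D; rewrite KP => /andP[].
Qed.

(** The sign that the term of [s] in the determinant has for every matrix in the class of [P]; it is
    0 if an arc is missing. *)
Definition leibniz_sign : int := (-1) ^+ s * \prod_i arc_sign i.

Lemma leibniz_sign_porbits : leibniz_sign = \prod_(C in porbits s) porbit_sign C.
Proof. by rewrite /leibniz_sign (sign_perm_porbits s) (big_porbits s) -big_split. Qed.

Lemma leibniz_sign_neq0 i : leibniz_sign != 0 -> arc_sign i != 0.
Proof. by rewrite /leibniz_sign (bigD1 i) //= mulrCA mulf_eq0 negb_or => /andP[]. Qed.

Lemma composite_leibniz_sign :
  (0 < n)%N -> leibniz_sign != 0 ->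
  exists C, [/\ composite_cycle P C, composite_length C = n & composite_sign P C = leibniz_sign].
Proof.
move=> n_gt0 sign_neq0; have [|||C [CP lenC signC]] := composite_porbit_cycles (S := setT).
- by rewrite -card_gt0 cardsT card_ord.
- by [].
- by move=> i _; apply: leibniz_sign_neq0.
exists C; split=> //; first by rewrite lenC cardsT card_ord.
by rewrite signC leibniz_sign_porbits; apply: eq_bigl => D; rewrite subsetT andbT.
Qed.

Lemma sgz_leibniz (R : realType) (A : 'M[R]_n) :
  qual_class P A -> sgz ((-1) ^+ s * \prod_i A i (s i)) = leibniz_sign.
Proof.
move=> AP; rewrite sgzM sgzX sgzN1 (big_morph _ (@sgzM R) (sgz1 R)).
by congr (_ * _); apply: eq_bigr => i _; rewrite AP.
Qed.

Lemma arc_sign_sqr i : arc_sign i != 0 -> arc_sign i ^+ 2 = 1.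
Proof. by rewrite /arc_sign; case: (P i (s i)). Qed.

Lemma porbit_sign_sqr (C : {set 'I_n}) : {in C, forall i, arc_sign i != 0} -> porbit_sign C ^+ 2 = 1.
Proof.
move=> arcC; rewrite exprMn sqrr_sign mul1r -prodrXl.
by apply: big1 => i iC; rewrite arc_sign_sqr ?arcC.
Qed.

End PermutationCycles.

(** * Terms of opposite signs in the determinant *)

Lemma opposite_summands (R : realDomainType) (I : finType) (f : I -> R) (i0 : I) :
  f i0 != 0 -> \sum_i f i = 0 -> (exists i, 0 < f i) /\ exists i, f i < 0.
Proof.
have pos (g : I -> R) : g i0 != 0 -> \sum_i g i = 0 -> exists i, 0 < g i.
  move=> g0 sum0; apply/existsP; apply: contraNT g0 => /existsPn g_le0.
  have sumN0 : \sum_i - g i = 0 by rewrite sumrN sum0 oppr0.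
  have gN_ge0 i : true -> 0 <= - g i by rewrite oppr_ge0 leNgt.
  by rewrite -oppr_eq0; apply/eqP/(psumr_eq0P gN_ge0 sumN0).
move=> f0 sum0; split; first exact: pos.
have [||i] := pos (fun i => - f i); first by rewrite oppr_eq0.
  by rewrite sumrN sum0 oppr0.
by rewrite oppr_gt0 => fi; exists i.
Qed.

(** If all terms were 0, every matrix of the class would be singular; so some term is nonzero, and
    in a singular matrix it has to be cancelled. *)
Lemma opposite_leibniz_signs (R : realType) (n : nat) (P : 'M[sign]_n) :
  allows_singularity R P -> ~ sign_singular R P ->
  (exists s, leibniz_sign P s = 1) /\ (exists t, leibniz_sign P t = -1).
Proof.
move=> [A [AP]]; rewrite unitmxE unitfE negbK => /eqP detA P_nonsing.
pose f (s : 'S_n) := (-1) ^+ s * \prod_i A i (s i).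
have [s0 s0P|no_term] := pickP [pred s | leibniz_sign P s != 0]; last first.
  case: P_nonsing => B BP; rewrite unitmxE unitfE negbK; apply/eqP/big1 => s _.
  by apply/eqP; rewrite -sgz_eq0 (sgz_leibniz _ BP); have /negbFE := no_term s.
have f0 : f s0 != 0 by rewrite -sgz_eq0 (sgz_leibniz _ AP).
have [[s fs] [t ft]] := opposite_summands f0 detA.
by split; [exists s; rewrite -(sgz_leibniz s AP) gtr0_sgz
         | exists t; rewrite -(sgz_leibniz t AP) ltr0_sgz].
Qed.

(** * Composite cycles and coefficients of the characteristic polynomial *)

(* A nonzero coefficient of [x ^ (n - k)] needs a product of disjoint cycles
   of total length [k]. *)
Lemma char_poly_coef_eq0 (R : comNzRingType) (n k : nat) (A : 'M[R]_n) :
  (k <= n)%N ->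
  (forall (s : 'S_n) (S : {set 'I_n}), #|S| = k -> (forall i, i \notin S -> s i = i) ->
     exists2 i, i \in S & A i (s i) = 0) ->
  (char_poly A)`_(n - k) = 0.
Proof.
move=> le_kn vanish; rewrite coef_sum big1 // => s _.
(* Each entry is a sum of a constant and a multiple of ['X]. In the expanded product [f] records the
   choices, and the rows [S] with a constant chosen leave the power [#|~: S|] of ['X]. *)
pose F i (b : bool) : {poly R} := if b then - (A i (s i))%:P else 'X *+ (i == s i).
have -> : \prod_i char_poly_mx A i (s i) = \prod_i \sum_b F i b.
  by apply: eq_bigr => i _; rewrite big_bool !mxE /F addrC.
rewrite bigA_distr_bigA /= mulr_sumr coef_sum big1 // => f _.
suff prod0 : (\prod_i F i (f i))`_(n - k) = 0.
  by rewrite mulr_sign; case: ifP => _; rewrite ?coefN prod0 ?oppr0.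
pose S := [set i | f i].
have [/existsP[i /andP[fi si]]|] := boolP [exists i, ~~ f i && (i != s i)].
  by rewrite (bigD1 i) //= /F (negPf fi) (negPf si) mulr0n mul0r coef0.
move=> /existsPn fixS.
have s_out i : i \notin S -> s i = i.
  by rewrite inE => fi; have := fixS i; rewrite fi negbK => /eqP.
have -> : \prod_i F i (f i) = (\prod_(i in S) - A i (s i))%:P * 'X^#|~: S|.
  rewrite (bigID (mem S)) /= rmorph_prod; congr (_ * _).
    by apply: eq_bigr => i; rewrite inE /F => ->; rewrite rmorphN.
  rewrite -prodr_const; apply: eq_big => i; first by rewrite !inE.
  by move=> iS; move: (iS); rewrite inE /F => /negPf->; rewrite s_out // eqxx.
rewrite coefCM coefXn; have [cardS|] := eqVneq; last by rewrite mulr0.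
have cardSk : #|S| = k.
  have := cardsC S; rewrite -cardS card_ord => Sn.
  by apply/eqP; rewrite -(eqn_add2r (n - k)) Sn subnKC.
have [i iS Ai] := vanish s S cardSk s_out.
by rewrite (bigD1 i) //= Ai oppr0 !mul0r.
Qed.

Lemma has_composite_cycle_or_coef0 (R : realType) (n k : nat) (P : 'M[sign]_n) :
  (0 < k <= n)%N -> has_composite_cycle P k \/
  forall A : 'M[R]_n, qual_class P A -> (char_poly A)`_(n - k) = 0.
Proof.
move=> /andP[k_gt0 le_kn].
have [/existsP[s /existsP[S /and3P[/eqP cardS /forallP s_out /forallP arcS]]]|] :=
  boolP [exists s : 'S_n, exists S : {set 'I_n},
    [&& #|S| == k, [forall i, (i \notin S) ==> (s i == i)]
      & [forall i, (i \in S) ==> (arc_sign P s i != 0)]]].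
  left; have [|||C [CP lenC _]] := @composite_porbit_cycles n P s S.
  - by rewrite -card_gt0 cardS.
  - move=> i iS; apply: contraT => siS; have /implyP/(_ siS) := s_out (s i).
    by move=> /eqP/perm_inj sii; rewrite sii iS in siS.
  - by move=> i iS; apply: (implyP (arcS i)).
  by exists C; rewrite lenC.
move=> /existsPn none; right=> A AP; apply: char_poly_coef_eq0 => // s S cardS s_out.
have /existsPn/(_ S) := none s; rewrite cardS eqxx /= negb_and.
have -> /= : [forall i, (i \notin S) ==> (s i == i)].
  by apply/forallP=> i; apply/implyP=> /s_out->.
move=> /forallPn[i]; rewrite negb_imply negbK => /andP[iS arc0].
by exists i => //; apply/eqP; rewrite -sgz_eq0 AP.
Qed.

Lemma loop_has_composite_cycle (n : nat) (P : 'M[sign]_n) (s : 'S_n) (i : 'I_n) :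
  leibniz_sign P s != 0 -> s i = i -> has_composite_cycle P 1.
Proof.
move=> sign_s si; have [|||C [CP lenC _]] := @composite_porbit_cycles n P s [set i].
- by rewrite -card_gt0 cards1.
- by move=> j /set1P->; rewrite si set11.
- by move=> j _; apply: leibniz_sign_neq0.
by exists C; rewrite lenC cards1.
Qed.

(** For [n <= 1] there is only one permutation, hence only one sign. *)
Lemma leibniz_sign_order (n : nat) (P : 'M[sign]_n) (s t : 'S_n) :
  leibniz_sign P s = 1 -> leibniz_sign P t = -1 -> (1 < n)%N.
Proof.
move=> s1 t1; have st : s != t by apply/eqP=> st; rewrite st t1 in s1.
rewrite ltnNge; apply: contraNN st => n_le1; apply/eqP/permP=> i.
by apply: ord_inj; have := ltn_ord (s i); have := ltn_ord (t i); lia.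
Qed.

Lemma Delta_composite_cycle (R : realType) (n : nat) (P : 'M[sign]_n) :
  allows_singularity R P -> ~ sign_singular R P -> in_Delta R P ->
  ~ has_composite_cycle P (n - 1) -> has_composite_cycle P (n - 2).
Proof.
move=> Psing Pnonsing PDelta no_n1.
have [[s s1] [t t1]] := opposite_leibniz_signs Psing Pnonsing.
have n_gt1 := leibniz_sign_order s1 t1.
(* For [n = 2] the length [n - 2] is 0, which no composite cycle has. There one of the distinct [s]
   and [t] is the identity, and its loops have length [n - 1]. *)
have [n_le2|n_gt2] := leqP n 2.
  case: no_n1; have n2 : n = 2 by apply/eqP; rewrite eqn_leq n_le2.
  have st : s != t by apply/eqP=> st; rewrite st t1 in s1.
  have -> : (n - 1 = 1)%N by rewrite n2.
  have [/existsP[i /eqP si]|/existsPn s_free] := boolP [exists i, s i == i].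
    by apply: loop_has_composite_cycle si; rewrite s1.
  have [/existsP[i /eqP ti]|/existsPn t_free] := boolP [exists i, t i == i].
    by apply: loop_has_composite_cycle ti; rewrite t1.
  case/eqP: st; apply/permP=> i; apply: ord_inj.
  have := s_free i; have := t_free i; rewrite -!val_eqE /=.
  by have := ltn_ord i; have := ltn_ord (s i); have := ltn_ord (t i); lia.
case: (@has_composite_cycle_or_coef0 R n (n - 2) P) => // [|coef2]; first by lia.
case: (@has_composite_cycle_or_coef0 R n (n - 1) P) => // [|coef1]; first by lia.
have [A [AP]] := Psing; rewrite unitmxE unitfE negbK => /eqP detA.
have p_neq0 := monic_neq0 (char_poly_monic A).
(* The coefficients of degrees 0, 1 and 2 vanish, the first because [A] is singular, so ['X^3]
   divides the polynomial. *)
have mup0 : (2 < mup 0 (char_poly A))%N.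
  rewrite mup_geq // subr0; have := poly_take_drop 3 (char_poly A).
  rewrite (_ : take_poly 3 _ = 0) ?add0r => [<-|]; first exact: dvdp_mulIr.
  apply/polyP=> i; rewrite coef_take_poly coef0; case: ifP => // i_lt3.
  have [->|i0] := eqVneq i 0%N; first by rewrite char_poly_det detA mulr0.
  have [->|i1] := eqVneq i 1%N; first by have := coef1 A AP; have -> : (n - (n - 1) = 1)%N by lia.
  by have := coef2 A AP; have -> : (n - (n - 2) = i)%N by lia.
have [r [r_uniq r_eig mup2]] := PDelta A AP.
have r0 : 0 \in r.
  by rewrite r_eig eigenvalue_root_char root_factor_theorem XsubC_dvd // (ltn_trans _ mup0).
by move: mup0; rewrite -mup2 (bigD1_seq 0) //= ltnNge leq_addr.
Qed.

(** * Parity and signs of the cycles of one permutation *)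

Section OddEvenCycles.

Variables (n : nat) (P : 'M[sign]_n) (s : 'S_n).
Hypotheses (n_even : ~~ odd n) (sign_neq0 : leibniz_sign P s != 0).

Let arcs i : arc_sign P s i != 0.
Proof. exact: leibniz_sign_neq0. Qed.

Lemma porbit_sign_pm1 (C : {set 'I_n}) : porbit_sign P s C = 1 \/ porbit_sign P s C = -1.
Proof.
by have /eqP := porbit_sign_sqr (C := C) (in1W arcs); rewrite sqrf_eq1 => /pred2P.
Qed.

Lemma sum_card_porbits : (\sum_(C in porbits s) #|C|)%N = n.
Proof.
rewrite -[RHS]card_ord -[RHS]sum1_card [RHS](eq_bigl xpredT) // [RHS](big_porbits s addn).
by apply: eq_bigr => C _; rewrite sum1_card.
Qed.

Lemma disjoint_odd_cycles (C D : {set 'I_n}) :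
  C \in porbits s -> D \in porbits s -> odd #|C| -> odd #|D| -> C != D ->
  [/\ simple_cycle P (porbit_cycle s C) /\ odd (size (porbit_cycle s C)),
      simple_cycle P (porbit_cycle s D) /\ odd (size (porbit_cycle s D))
    & vertex_disjoint (porbit_cycle s C) (porbit_cycle s D)].
Proof.
move=> Cs Ds oddC oddD CD; rewrite !size_porbit_cycle //.
by rewrite !simple_porbit_cycle ?disjoint_porbit_cycle //; apply: in1W.
Qed.

Lemma negative_even_or_opposite_odd :
  leibniz_sign P s < 0 ->
  (exists c, [/\ simple_cycle P c, ~~ odd (size c) & cycle_sign P c < 0])
  \/ (exists c d, [/\ simple_cycle P c /\ odd (size c),
        simple_cycle P d /\ odd (size d), vertex_disjoint c d
      & cycle_sign P c = - cycle_sign P d]).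
Proof.
move=> sign_lt0.
have [/exists_inP[C Cs /andP[evenC negC]]|/exists_inPn even_pos] :=
    boolP [exists C in porbits s, ~~ odd #|C| && (porbit_sign P s C < 0)].
  left; exists (porbit_cycle s C).
  rewrite size_porbit_cycle ?cycle_sign_porbit_cycle //; split=> //.
  by apply: simple_porbit_cycle => //; apply: in1W.
right.
have evenE C : C \in porbits s -> ~~ odd #|C| -> porbit_sign P s C = 1.
  move=> Cs evenC; have := even_pos C Cs; rewrite evenC /=.
  by case: (porbit_sign_pm1 C) => ->.
(* Otherwise all odd cycles have the same sign [e], so that the sign of [s] is
   [e ^ n = 1]. *)
have prod_e (e : int) : e ^+ 2 = 1 ->
    {in porbits s, forall C : {set 'I_n}, odd #|C| -> porbit_sign P s C = e} -> False.
  move=> e2 oddE; move: sign_lt0; rewrite leibniz_sign_porbits.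
  (* The power [e ^ #|C|] is [e] on odd orbits and 1 on even ones, so it fits both. *)
  rewrite (eq_bigr (fun C : {set 'I_n} => e ^+ #|C|)) => [|C Cs].
    rewrite -expr_sum sum_card_porbits -[n]odd_double_half (negPf n_even) add0n.
    by rewrite -mul2n exprM e2 expr1n.
  rewrite -[in RHS](odd_double_half #|C|) -mul2n exprD exprM e2 expr1n mulr1.
  by have [/oddE->|/evenE->] := boolP (odd #|C|).
have [/exists_inP[C Cs oddC]|/exists_inPn no_odd] := boolP [exists C in porbits s, odd #|C|];
  last first.
  by case: (prod_e 1 (expr1n _ _)) => C /no_odd/negPf->.
have [/exists_inP[D Ds /andP[oddD /eqP signD]]|/exists_inPn same] :=
    boolP [exists D in porbits s, odd #|D| && (porbit_sign P s C == - porbit_sign P s D)].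
  have CD : C != D.
    by apply/eqP=> CD; move: signD; rewrite CD; case: (porbit_sign_pm1 D) => ->.
  have [sC sD dCD] := disjoint_odd_cycles Cs Ds oddC oddD CD.
  by exists (porbit_cycle s C), (porbit_cycle s D); rewrite !cycle_sign_porbit_cycle.
case: (prod_e (porbit_sign P s C) (porbit_sign_sqr (in1W arcs))) => D Ds oddD.
have := same D Ds; rewrite oddD /=.
by case: (porbit_sign_pm1 C) (porbit_sign_pm1 D) => -> [] ->.
Qed.

Lemma same_sign_odd (C : {set 'I_n}) :
  leibniz_sign P s = 1 -> C \in porbits s -> odd #|C| ->
  {in porbits s, forall D : {set 'I_n}, ~~ odd #|D| -> porbit_sign P s D = 1} ->
  exists c d, [/\ simple_cycle P c /\ odd (size c),
        simple_cycle P d /\ odd (size d), vertex_disjoint c d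
      & cycle_sign P c = cycle_sign P d].
Proof.
move=> sign1 Cs oddC evenE.
have [/exists_inP[D Ds /and3P[oddD CD /eqP signD]]|/exists_inPn diff] :=
    boolP [exists D in porbits s, [&& odd #|D|, C != D & porbit_sign P s C == porbit_sign P s D]].
  have [sC sD dCD] := disjoint_odd_cycles Cs Ds oddC oddD CD.
  by exists (porbit_cycle s C), (porbit_cycle s D); rewrite !cycle_sign_porbit_cycle.
(* If all other odd cycles have the sign [e] opposite to that of [C], the sign
   of [s] is [- e * e ^ (n - |C|) = -1], since [n - |C|] is odd. *)
pose e := - porbit_sign P s C.
have e2 : e ^+ 2 = 1 by rewrite sqrrN (porbit_sign_sqr (in1W arcs)).
have odd_rest : odd (\sum_(D in porbits s | D != C) #|D|)%N.
  have := congr1 odd sum_card_porbits; rewrite (bigD1 C) //= oddD oddC (negPf n_even).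
  by move/negbFE.
move: sign1; rewrite leibniz_sign_porbits (bigD1 C) //=.
rewrite (eq_bigr (fun D : {set 'I_n} => e ^+ #|D|)) => [|D /andP[Ds DC]].
  rewrite -expr_sum -[X in e ^+ X](odd_double_half) odd_rest exprD -mul2n exprM e2.
  rewrite expr1n mulr1 expr1 /e.
  by case: (porbit_sign_pm1 C) => ->.
rewrite -[in RHS](odd_double_half #|D|) -mul2n exprD exprM e2 expr1n mulr1.
have [oddD|/evenE->//] := boolP (odd #|D|).
have := diff D Ds; rewrite oddD eq_sym DC /= /e.
by case: (porbit_sign_pm1 C) (porbit_sign_pm1 D) => -> [] ->.
Qed.

End OddEvenCycles.

(** * Matrices close to a weighted permutation *)

(** A small positive multiple of the sign matrix of [P] brings the weighted permutation matrix into
    the class: on the arcs of [s] the signs agree, elsewhere the multiple stands alone. *)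
Lemma char_poly_weighted_perturbation (R : realType) (n : nat) (P : 'M[sign]_n) (s : 'S_n)
    (w : 'I_n -> R) (eta : R) :
  leibniz_sign P s != 0 -> (forall i, 0 <= w i) -> 0 < eta ->
  exists2 A, qual_class P A & forall x,
    `|(char_poly A).[x] - \prod_(C in porbits s)
        (x ^+ #|C| - (\prod_(i in C) w i) * (\prod_(i in C) arc_sign P s i)%:~R)|
      <= eta * (1 + `|x| ^+ n).
Proof.
move=> sign_neq0 w_ge0 eta_gt0.
pose v i := w i * (arc_sign P s i)%:~R.
pose A0 : 'M[R]_n := \matrix_(i, j) (v i *+ (j == s i)).
pose B : 'M[R]_n := \matrix_(i, j) (sign_val (P i j))%:~R.
have [e e_gt0 eP] := char_poly_perturbation A0 B eta_gt0.
exists (A0 + e *: B) => [i j|x].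
  rewrite !mxE; have [->|_] := eqVneq j (s i); last first.
    by rewrite mulr0n add0r sgzM gtr0_sgz // mul1r; case: (P i j); rewrite /= ?sgzN ?sgz1 ?sgz0.
  rewrite mulr1n /v /arc_sign -mulrDl sgzM gtr0_sgz ?ltr_wpDl // mul1r.
  by case: (P i (s i)); rewrite /= ?sgzN ?sgz1 ?sgz0.
rewrite (_ : \prod_(C in _) _ = (char_poly A0).[x]) //.
rewrite horner_char_poly det_weighted_perm; apply: eq_bigr => C _.
by rewrite /v big_split /= rmorph_prod.
Qed.

Section PositiveTerm.

Variables (R : realType) (n : nat) (P : 'M[sign]_n) (s : 'S_n).
Hypotheses (PDelta : in_Delta R P) (n_even : ~~ odd n) (sign1 : leibniz_sign P s = 1).

Let sign_neq0 : leibniz_sign P s != 0. Proof. by rewrite sign1. Qed.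

Let arc_prodE (C : {set 'I_n}) :
  \prod_(i in C) arc_sign P s i = (-1) ^+ #|C|.-1 * porbit_sign P s C.
Proof. by rewrite /porbit_sign mulrA -expr2 sqrr_sign mul1r. Qed.

(* Weight the cycle [C0] by 2 per vertex and the other cycles by 1/2: the
   characteristic polynomial of the weighted permutation matrix is then
   negative at 1 and -1, and positive at 0. *)
Lemma positive_term_even_cycle (C0 : {set 'I_n}) :
  C0 \in porbits s -> ~~ odd #|C0| -> porbit_sign P s C0 = 1.
Proof.
move=> C0s evenC0; case: (porbit_sign_pm1 sign_neq0 C0) => // negC0; exfalso.
pose w i : R := if i \in C0 then 2 else 2^-1.
have w_gt0 i : 0 < w i by rewrite /w; case: ifP => _; rewrite ?invr_gt0 ltr0n.
pose W (C : {set 'I_n}) := \prod_(i in C) w i.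
have W_gt0 C : 0 < W C by apply: prodr_gt0.
pose p (x : R) := \prod_(C in porbits s)
  (x ^+ #|C| - W C * (\prod_(i in C) arc_sign P s i)%:~R).
have W_C0 : 1 < W C0.
  rewrite /W (eq_bigr (fun=> 2)) => [|i iC0]; last by rewrite /w iC0.
  by rewrite prodr_const exprn_egt1 ?ltr1n // -lt0n (porbits_card_gt0 C0s).
have W_lt1 C : C \in porbits s -> C != C0 -> W C < 1.
  move=> Cs CC0; rewrite /W (eq_bigr (fun=> 2^-1)) => [|i iC]; last first.
    by rewrite /w (disjointFr (porbits_disjoint Cs C0s CC0) iC).
  rewrite prodr_const exprn_ilt1 ?invr_ge0 ?ler0n ?invf_lt1 ?ltr0n ?ltr1n //.
  by rewrite -lt0n (porbits_card_gt0 Cs).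
have p_sign_lt0 (b : bool) : p ((-1) ^+ b) < 0.
  set y : R := (-1) ^+ b.
  have yy k : y ^+ k * y ^+ k = 1 by rewrite -expr2 -exprM mulnC exprM sqrr_sign expr1n.
  (* Pulling [y ^ #|C|] out of each factor costs [y ^ n] in total, which is 1 since [n] is even. *)
  have -> : p y = \prod_(C in porbits s)
      (1 - y ^+ #|C| * (W C * (\prod_(i in C) arc_sign P s i)%:~R)).
    transitivity (\prod_(C in porbits s) (y ^+ #|C| *
        (1 - y ^+ #|C| * (W C * (\prod_(i in C) arc_sign P s i)%:~R)))).
      by apply: eq_bigr => C _; rewrite mulrBr mulr1 [y ^+ _ * (y ^+ _ * _)]mulrA yy mul1r.
    rewrite big_split /= -expr_sum (sum_card_porbits s).
    rewrite -[n in y ^+ n]odd_double_half (negPf n_even) add0n -mul2n exprM sqrr_sign.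
    by rewrite expr1n mul1r.
  (* The factor of [C0] becomes [1 - W C0 < 0]; every other one is positive because [W C < 1]. *)
  rewrite (bigD1 C0) //= nmulr_rlt0.
    apply: prodr_gt0 => C /andP[Cs CC0]; rewrite subr_gt0.
    apply: le_lt_trans (ler_norm _) _.
    rewrite !normrM normrX normrX normrN1 !expr1n mul1r arc_prodE.
    rewrite gtr0_norm // rmorphM normrM rmorphXn /= normrX normrN1 expr1n mul1r.
    have -> : `|(porbit_sign P s C)%:~R| = 1 :> R.
      by case: (porbit_sign_pm1 sign_neq0 C) => ->; rewrite ?normrN1 ?normr1.
    by rewrite mulr1 W_lt1.
  rewrite arc_prodE negC0; have C0_gt0 := porbits_card_gt0 C0s.
  have -> : (-1) ^+ #|C0|.-1 * -1 = 1 :> int.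
    by rewrite mulrC -exprS prednK // -signr_odd (negPf evenC0).
  rewrite mulr1 -[X in y ^+ X]odd_double_half (negPf evenC0) add0n -mul2n exprM sqrr_sign.
  by rewrite expr1n mul1r subr_lt0.
have p0_gt0 : 0 < p 0.
  have -> : p 0 = \prod_(C in porbits s) W C * (\prod_(C in porbits s) ((-1) ^+ #|C| * porbit_sign P s C))%:~R.
    rewrite rmorph_prod -big_split /=; apply: eq_bigr => C Cs.
    rewrite expr0n (gtn_eqF (porbits_card_gt0 Cs)) sub0r -mulrN -rmorphN /=.
    congr (_ * _%:~R); rewrite arc_prodE -mulNr; congr (_ * _).
    by rewrite -[in RHS](prednK (porbits_card_gt0 Cs)) exprS mulN1r.
  rewrite big_split /= -expr_sum (sum_card_porbits s) -leibniz_sign_porbits sign1.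
  rewrite -signr_odd (negPf n_even) expr0 !mulr1; apply: prodr_gt0 => C _.
  exact: W_gt0.
have p1_lt0 := p_sign_lt0 false; have pN1_lt0 := p_sign_lt0 true.
rewrite expr0 in p1_lt0; rewrite expr1 in pN1_lt0.
(* At the three points [1 + |x| ^ n] is at most 2, so an error rate of [d / 4] moves the values by
   at most [d / 2] and keeps their signs. *)
pose d := Num.min (p 0) (Num.min (- p 1) (- p (-1))).
have d_gt0 : 0 < d by rewrite !lt_min p0_gt0 !oppr_gt0 p1_lt0.
have d4_gt0 : 0 < d / 4 by rewrite divr_gt0.
have [A AP Ap] := char_poly_weighted_perturbation sign_neq0 (fun i => ltW (w_gt0 i)) d4_gt0.
have near x : `|x| <= 1 -> `|(char_poly A).[x] - p x| <= d / 2.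
  move=> x_le1; apply: le_trans (Ap x) _.
  have : `|x| ^+ n <= 1 by rewrite exprn_ile1.
  by nra.
have d_p0 : d <= p 0 by rewrite /d ge_min lexx.
have d_p1 : d <= - p 1 by rewrite /d !ge_min lexx orbT.
have d_pN1 : d <= - p (-1) by rewrite /d !ge_min lexx !orbT.
have x0 : `|0 : R| <= 1 by rewrite normr0.
have x1 : `|1 : R| <= 1 by rewrite normr1.
have xN1 : `|-1 : R| <= 1 by rewrite normrN1.
have := two_real_eigenvalues_sign (PDelta AP).
move: (near _ x0) (near _ x1) (near _ xN1); rewrite !ler_distl.
lra.
Qed.

Lemma positive_term_odd_cycle : exists2 C, C \in porbits s & odd #|C|.
Proof.
apply/exists_inP; apply: contraT => /exists_inPn no_odd; exfalso.
have arc_prod C : C \in porbits s -> \prod_(i in C) arc_sign P s i = -1.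
  move=> Cs; rewrite arc_prodE (positive_term_even_cycle Cs (no_odd C Cs)) mulr1.
  have := no_odd C Cs; rewrite -{1}(prednK (porbits_card_gt0 Cs)) /= negbK.
  by rewrite -signr_odd => ->.
(* The product is at least 1 and at least [|x| ^ n], hence at least half of [1 + |x| ^ n]; an error
   rate below one half cannot create a root. *)
have quarter_gt0 : 0 < 4^-1 :> R by rewrite invr_gt0.
have [A AP Ap] := char_poly_weighted_perturbation sign_neq0 (fun=> ler01) quarter_gt0.
have [x px0] := two_real_eigenvalues_exists (PDelta AP).
have := Ap x; rewrite px0 sub0r normrN.
rewrite (eq_bigr (fun C : {set 'I_n} => 1 + `|x| ^+ #|C|)) => [|C Cs]; last first.
  rewrite arc_prod // big1 // mul1r rmorphN1 opprK addrC; congr (_ + _).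
  by rewrite -normrX ger0_norm // exprn_even_ge0 ?no_odd.
have prod_ge1 : 1 <= \prod_(C in porbits s) (1 + `|x| ^+ #|C|).
  elim/big_ind: _ => // [a b a1 b1|C _]; last by rewrite lerDl exprn_ge0.
  by rewrite -[1]mulr1 ler_pM.
have prod_gen : `|x| ^+ n <= \prod_(C in porbits s) (1 + `|x| ^+ #|C|).
  rewrite -[n in _ ^+ n](sum_card_porbits s) expr_sum; apply: ler_prod => C _.
  by rewrite exprn_ge0 //= lerDr.
rewrite ger0_norm ?(le_trans ler01) //.
lra.
Qed.

End PositiveTerm.

Theorem theorem5p9 (R : realType) (n : nat) (P : 'M[sign]_n)
    (Psing : allows_singularity R P) (Pnonsing : ~ sign_singular R P)
    (PDelta : in_Delta R P) :
  [/\ exists C1 C2 : seq (seq 'I_n),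
        [/\ composite_cycle P C1 /\ composite_length C1 = n,
            composite_cycle P C2 /\ composite_length C2 = n
          & composite_sign P C1 = - composite_sign P C2],
      ~ has_composite_cycle P (n - 1) -> has_composite_cycle P (n - 2),
      (exists c : seq 'I_n,
         [/\ simple_cycle P c, ~~ odd (size c) & cycle_sign P c < 0])
      \/ (exists c d : seq 'I_n,
           [/\ simple_cycle P c /\ odd (size c),
               simple_cycle P d /\ odd (size d),
               vertex_disjoint c d
             & cycle_sign P c = - cycle_sign P d])
    & exists c d : seq 'I_n,
        [/\ simple_cycle P c /\ odd (size c),
            simple_cycle P d /\ odd (size d),
            vertex_disjoint c d
          & cycle_sign P c = cycle_sign P d]].
Proof.
have [[s s1] [t t1]] := opposite_leibniz_signs Psing Pnonsing.
have n_gt0 : (0 < n)%N := ltnW (leibniz_sign_order s1 t1).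
have s_neq0 : leibniz_sign P s != 0 by rewrite s1.
have t_neq0 : leibniz_sign P t != 0 by rewrite t1.
(* The singular matrix serves as a member of the class, whose non-real eigenvalues number
   [n - 2]. *)
have n_even : ~~ odd n.
  by have [A [AP _]] := Psing; have [] := two_real_eigenvalues (PDelta A AP).
split.
- have [C1 [C1P len1 sign1]] := composite_leibniz_sign n_gt0 s_neq0.
  have [C2 [C2P len2 sign2]] := composite_leibniz_sign n_gt0 t_neq0.
  by exists C1, C2; rewrite sign1 sign2 s1 t1 opprK.
- exact: Delta_composite_cycle Psing Pnonsing PDelta.
- by apply: negative_even_or_opposite_odd n_even t_neq0 _; rewrite t1.
- have [C Cs oddC] := positive_term_odd_cycle PDelta n_even s1.
  apply: (same_sign_odd n_even s_neq0 s1 Cs oddC) => D Ds.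
  exact: positive_term_even_cycle PDelta n_even s1 _ Ds.
Qed.
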